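(* Let $1\le k\le n$, let $\mathcal S\subset\mathcal P_n$ be the stabilizer group of a stabilizer code with logical Pauli group $\mathcal L$, and let $\tilde G\subset\tilde{\mathcal P}_n$ be a nontrivial subgroup. Let $p\in[0,1)$, $z=p/(3-3p)$, $p_{\rm DD}\in[0,1]$, and write $W(A)=W(A;z)$. Then the infidelity of the LDD-only protocol (error-correction setting, with random syndrome-consistent recovery) is $$1-F_{\rm LDD}=\frac{\bigl(W(U\setminus T)-4^{-k}W(U\setminus N)\bigr)+p_{\rm DD}\bigl(W(V\setminus T)-4^{-k}W(V\setminus N)\bigr)}{W(U)+p_{\rm DD}W(V)}.$$
   Context: Paulis. $\mathcal P_n$ is the $n$-qubit Pauli group (with phases $\pm1,\pm i$), $\tilde{\mathcal P}_n=\mathcal P_n/\langle iI\rangle$, and $\pi:\mathcal P_n\to\tilde{\mathcal P}_n$ is the projection. Elements of $\tilde{\mathcal P}_n$ are represented by strings in $\{I,X,Y,Z\}^n$; $\mathrm{wt}(E')$ is the number of non-identity letters. Two elements of $\tilde{\mathcal P}_n$ are said to commute (anticommute) if their representatives in $\mathcal P_n$ do. Code. $\mathcal S\subset\mathcal P_n$ is a subgroup with $2^{n-k}$ elements not containing $-I$. $C(\mathcal S)$ is its centralizer in $\mathcal P_n$. $\mathcal L\subseteq C(\mathcal S)$ is a subgroup with $C(\mathcal S)=\mathcal S\mathcal L$ and $\pi(\mathcal S)\cap\pi(\mathcal L)=\{\pi(I)\}$. $\mathcal S^*$ is the $\mathbb F_2$-dual of $\mathcal S$; the syndrome $\mathrm{syn}(E')\in\mathcal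 S^*$ is given by $\mathrm{syn}(E')(s)=1$ iff $E'$ anticommutes with $s$. Sets. $T=\pi(\mathcal S)$; $N=\pi(\mathcal S\mathcal L)=\pi(C(\mathcal S))$ (zero-syndrome errors); $U=\tilde G^\perp=\{E'\in\tilde{\mathcal P}_n: E'\text{ commutes with every element of }\tilde G\}$ (unsuppressed errors); $V=\tilde{\mathcal P}_n\setminus U$ (suppressed errors). For $A\subset\tilde{\mathcal P}_n$, $W(A;z)=\sum_{E'\in A}z^{\mathrm{wt}(E')}$. LDD-only protocol. A random error $E'\in\tilde{\mathcal P}_n$ is drawn from the distribution obtained from $(1-p)^{n-\mathrm{wt}(E')}(p/3)^{\mathrm{wt}(E')}$ by multiplying the probabilities of all $E'\in V$ by $p_{\rm DD}$ and renormalizing. The syndrome $\sigma=\mathrm{syn}(E')$ is measured. If $\sigma=0$, nothing is applied ($R=\pi(I)$). If $\sigma\ne0$, a uniformly random $R\in\tilde{\mathcal P}_n$ with $\mathrm{syn}(R)=\sigma$ is applied. $F_{\rm LDD}$ is the probability that $RE'\in T$ (no logical error). *)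

(* Defs.v *)
From HB Require Import structures.
From mathcomp Require Import all_boot all_order all_algebra all_fingroup.

Set Implicit Arguments.
Unset Strict Implicit.
Unset Printing Implicit Defensive.

Import Order.TTheory GRing.Theory Num.Theory GroupScope.
Local Open Scope ring_scope.

Inductive letter := lI | lX | lY | lZ.

Definition letter_code (a : letter) : bool * bool :=
  match a with
  | lI => (false, false) | lX => (true, false)
  | lY => (true, true)   | lZ => (false, true)
  end.
Definition letter_decode (c : bool * bool) : letter :=
  match c with
  | (false, false) => lI | (true, false) => lX
  | (true, true) => lY   | (false, true) => lZ
  end.
Lemma letter_codeK : cancel letter_code letter_decode. Proof. by case. Qed.
HB.instance Definition _ := Finite.copy letter (can_type letter_codeK).

(* As matrices, a * b = i ^ (lphase a b) (lmul a b): XY = iZ, YZ = iX, ZX = iY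
   (see [letter_mxM]). *)
Definition lmul (a b : letter) : letter :=
  match a, b with
  | lI, c | c, lI => c
  | lX, lX | lY, lY | lZ, lZ => lI
  | lX, lY | lY, lX => lZ
  | lY, lZ | lZ, lY => lX
  | lZ, lX | lX, lZ => lY
  end.
Definition lphase (a b : letter) : 'Z_4 :=
  match a, b with
  | lX, lY | lY, lZ | lZ, lX => 1
  | lY, lX | lZ, lY | lX, lZ => -1
  | _, _ => 0
  end.

Definition mx2 (C : numClosedFieldType) (a b c d : C) : 'M[C]_2 :=
  \matrix_(i, j) if i == 0 then (if j == 0 then a else b)
                 else (if j == 0 then c else d).
Definition letter_mx (C : numClosedFieldType) (a : letter) : 'M[C]_2 :=
  match a with
  | lI => mx2 1 0 0 1
  | lX => mx2 0 1 1 0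
  | lY => mx2 0 (- 'i) 'i 0
  | lZ => mx2 1 0 0 (-1)
  end.

Lemma letter_mxM (C : numClosedFieldType) (a b : letter) :
  letter_mx C a *m letter_mx C b = 'i ^+ (lphase a b) *: letter_mx C (lmul a b).
Proof.
have i2 : 'i * 'i = -1 :> C by rewrite -expr2 sqrCi.
have i3 : 'i ^+ 3 = - 'i :> C by rewrite exprS sqrCi mulrN1.
apply/matrixP=> i j; rewrite !mxE big_ord_recl big_ord1.
by case: a b => -[]; rewrite !mxE /=; case: ifP => _; case: ifP => _;
   rewrite ?expr0 ?expr1 ?i3 ?(mulr0, mul0r, mulr1, mul1r, add0r, addr0,
     mulrN, mulNr, mulrN1, mulN1r, i2, opprK, oppr0).
Qed.

(* [Pauli a s] is i ^ a times the tensor product of the letters of s. *)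
Record pauli (n : nat) :=
  Pauli { phase : 'Z_4; letters : {ffun 'I_n -> letter} }.

Definition pauli_code n (x : pauli n) := (phase x, letters x).
Definition pauli_decode n (c : 'Z_4 * {ffun 'I_n -> letter}) := Pauli c.1 c.2.
Lemma pauli_codeK n : cancel (@pauli_code n) (@pauli_decode n).
Proof. by case. Qed.
HB.instance Definition _ n := Finite.copy (pauli n) (can_type (@pauli_codeK n)).

Definition pauli_mul n (x y : pauli n) : pauli n :=
  Pauli (phase x + phase y + \sum_j lphase (letters x j) (letters y j))
        [ffun j => lmul (letters x j) (letters y j)].
Definition pauli_one n : pauli n := Pauli 0 [ffun=> lI].
Definition pauli_inv n (x : pauli n) : pauli n := Pauli (- phase x) (letters x).

Lemma lmulA : associative lmul. Proof. by do 3!case. Qed.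
Lemma lmul1 : left_id lI lmul. Proof. by case. Qed.
Lemma lmulV a : lmul a a = lI. Proof. by case: a. Qed.
Lemma lphaseA a b c :
  lphase b c + lphase a (lmul b c) = lphase a b + lphase (lmul a b) c.
Proof. by apply/eqP; case: a b c => [] [] []. Qed.
Lemma lphase1 a : lphase lI a = 0. Proof. by case: a. Qed.
Lemma lphaseV a : lphase a a = 0. Proof. by case: a. Qed.

Lemma pauli_mulA n : associative (@pauli_mul n).
Proof.
move=> x y z; rewrite /pauli_mul; congr Pauli => /=; last first.
  by apply/ffunP=> j; rewrite !ffunE lmulA.
rewrite -!addrA; congr (_ + (_ + _)).
rewrite [in RHS]addrCA; congr (_ + _); rewrite -!big_split /=.
by apply: eq_bigr => j _; rewrite !ffunE lphaseA.
Qed.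
Lemma pauli_mul1 n : left_id (pauli_one n) (@pauli_mul n).
Proof.
case=> a s; rewrite /pauli_mul; congr Pauli => /=.
  by rewrite big1 ?add0r ?addr0 // => j _; rewrite ffunE lphase1.
by apply/ffunP=> j; rewrite !ffunE lmul1.
Qed.
Lemma pauli_mulV n : left_inverse (pauli_one n) (@pauli_inv n) (@pauli_mul n).
Proof.
case=> a s; rewrite /pauli_mul; congr Pauli => /=.
  by rewrite addNr add0r big1 // => j _; rewrite lphaseV.
by apply/ffunP=> j; rewrite !ffunE lmulV.
Qed.
HB.instance Definition _ n := Finite_isGroup.Build (pauli n)
  (@pauli_mulA n) (@pauli_mul1 n) (@pauli_mulV n).

Definition iI n : pauli n := Pauli 1 [ffun=> lI].
Definition minusI n : pauli n := Pauli 2%:R [ffun=> lI].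

Notation phases n := <[iI n]>%g.
Notation ppauli n := (coset_of (phases n)).
Notation proj n := (coset (phases n)).

Definition anticommute n (x y : pauli n) : bool :=
  (x * y == minusI n * (y * x))%g.

Definition pcommute n (E F : ppauli n) : bool :=
  (repr E * repr F == repr F * repr E)%g.

Definition pwt n (x : pauli n) : nat := #|[set j | letters x j != lI]|.
Definition wt n (E : ppauli n) : nat := pwt (repr E).

Definition stabilizer_code n (k : nat) (S : {group pauli n}) : Prop :=
  #|S| = (2 ^ (n - k))%N /\ minusI n \notin S.

Definition logical_paulis n (S L : {group pauli n}) : Prop :=
  [/\ L \subset 'C(S)%g, 'C(S)%g = (S * L)%g
    & (S / phases n :&: L / phases n = 1)%g].

Definition dual n (S : {group pauli n}) : {set {ffun subg_of S -> 'F_2}} :=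
  [set f : {ffun subg_of S -> 'F_2} |
     [forall s, forall t, f (s * t)%g == f s + f t]].

Definition syn n (S : {group pauli n}) (E : ppauli n) :
    {ffun subg_of S -> 'F_2} :=
  [ffun s => (anticommute (repr E) (sgval s))%:R].

Definition stab_errors n (S : {group pauli n}) : {set ppauli n} :=
  (S / phases n)%g.
Definition zero_syn_errors n (S L : {group pauli n}) : {set ppauli n} :=
  (S * L / phases n)%g.
Definition unsuppressed n (G : {group ppauli n}) : {set ppauli n} :=
  [set E | [forall F in G, pcommute E F]].
Definition suppressed n (G : {group ppauli n}) : {set ppauli n} :=
  ~: unsuppressed G.

Definition wt_enum (R : realFieldType) n (A : {set ppauli n}) (z : R) : R :=
  \sum_(E in A) z ^+ wt E.

Definition err_weight (R : realFieldType) n (G : {group ppauli n}) (p pDD : R)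
    (E : ppauli n) : R :=
  (1 - p) ^+ (n - wt E) * (p / 3%:R) ^+ wt E *
  (if E \in suppressed G then pDD else 1).
Definition err_prob (R : realFieldType) n (G : {group ppauli n}) (p pDD : R)
    (E : ppauli n) : R :=
  err_weight G p pDD E / \sum_F err_weight G p pDD F.

(* Conditional probability of applying Q when the measured syndrome is sigma. *)
Definition recovery_prob (R : realFieldType) n (S : {group pauli n})
    (sigma : {ffun subg_of S -> 'F_2}) (Q : ppauli n) : R :=
  if sigma == 0 then (Q == 1%g)%:R
  else (syn S Q == sigma)%:R / #|[set Q' | syn S Q' == sigma]|%:R.

Definition F_LDD (R : realFieldType) n (S : {group pauli n})
    (G : {group ppauli n}) (p pDD : R) : R :=
  \sum_E \sum_(Q | (Q * E)%g \in stab_errors S)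
    err_prob G p pDD E * recovery_prob R (syn S E) Q.

(* [repr] picks an arbitrary representative of a coset; the lemmas below show
   that the notions defined through it do not depend on this choice. *)
Lemma iIX n m : (iI n ^+ m)%g = Pauli m%:R [ffun=> lI].
Proof.
elim: m => [//|m IHm]; rewrite expgS IHm; congr Pauli => /=.
  by rewrite big1 ?addr0 -?natr1 1?addrC // => j _; rewrite ffunE lphase1.
by apply/ffunP=> j; rewrite !ffunE.
Qed.

Lemma minusIE n : minusI n = (iI n ^+ 2)%g. Proof. by rewrite iIX. Qed.

Lemma iI_central n (x : pauli n) : commute (iI n) x.
Proof.
congr Pauli => /=; last by apply/ffunP=> j; rewrite !ffunE; case: (letters x j).
by rewrite [1 + _]addrC; congr (_ + _); apply: eq_bigr => j _;
  rewrite !ffunE; case: (letters x j).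
Qed.

Lemma phases_central n c (x : pauli n) : c \in phases n -> commute c x.
Proof.
by case/cycleP=> m ->; apply/commute_sym/commuteX/commute_sym/iI_central.
Qed.

Lemma in_norm_phases n (x : pauli n) : x \in 'N(phases n)%g.
Proof.
apply: (subsetP (cent_sub _)); apply/centP=> c /phases_central cC.
exact/commute_sym/cC.
Qed.

Lemma repr_proj n (x : pauli n) :
  exists2 c, c \in phases n & repr (proj n x) = (c * x)%g.
Proof.
by rewrite val_coset ?in_norm_phases //; case: repr_rcosetP => c cP; exists c.
Qed.

Lemma proj_surj n (E : ppauli n) : proj n (repr E) = E.
Proof. exact: coset_reprK. Qed.

Lemma letters_phaseM n c (x : pauli n) :
  c \in phases n -> letters (c * x)%g = letters x.
Proof.
case/cycleP=> m ->; rewrite iIX.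
by apply/ffunP=> j; rewrite !ffunE lmul1.
Qed.

Lemma wt_proj n (x : pauli n) : wt (proj n x) = pwt x.
Proof. by rewrite /wt; have [c cP ->] := repr_proj x; rewrite /pwt letters_phaseM. Qed.

Lemma pcommute_proj n (x y : pauli n) :
  pcommute (proj n x) (proj n y) = (x * y == y * x)%g.
Proof.
rewrite /pcommute; have [c cP ->] := repr_proj x; have [d dP ->] := repr_proj y.
have -> : (c * x * (d * y) = c * d * (x * y))%g.
  by rewrite !mulgA -(mulgA c x d) -(phases_central x dP) !mulgA.
have -> : (d * y * (c * x) = c * d * (y * x))%g.
  by rewrite (phases_central d cP) !mulgA -(mulgA d y c) -(phases_central y cP) !mulgA.
by rewrite (inj_eq (mulgI _)).
Qed.

Lemma syn_proj n (S : {group pauli n}) (x : pauli n) s :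
  syn S (proj n x) s = (anticommute x (sgval s))%:R.
Proof.
rewrite ffunE /anticommute; have [c cP ->] := repr_proj x.
have -> : (minusI n * (sgval s * (c * x)) = c * (minusI n * (sgval s * x)))%g.
  rewrite !mulgA -(mulgA (minusI n)) -(phases_central (sgval s) cP) !mulgA.
  by rewrite (phases_central _ cP).
by rewrite -mulgA (inj_eq (mulgI _)).
Qed.

Lemma minusI_neq1 n : minusI n != 1%g.
Proof. by apply/eqP=> /(congr1 (@phase n)). Qed.

Lemma pauli_ext n (x y : pauli n) :
  phase x = phase y -> letters x = letters y -> x = y.
Proof. by case: x y => [a s] [b t] /= -> ->. Qed.

Lemma commute_or_anticommute n (x y : pauli n) :
  (x * y = y * x \/ x * y = minusI n * (y * x))%g.
Proof.
pose a j := lphase (letters x j) (letters y j).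
pose b j := lphase (letters y j) (letters x j).
have ab : \sum_j a j = \sum_j b j \/ \sum_j a j = 2%:R + \sum_j b j.
  apply: (big_ind2 (fun u v : 'Z_4 => u = v \/ u = 2%:R + v)); first by left.
    move=> u1 v1 u2 v2 [] -> [] ->; [left | right | right | left] => //.
    - by rewrite addrCA.
    - by rewrite addrA.
    - by rewrite addrACA (_ : 2%:R + 2%:R = 0) ?add0r //; apply/eqP.
  by move=> j _; rewrite /a /b; case: (letters x j); case: (letters y j);
    (by left) || (by right; apply/eqP).
have ls : letters (x * y)%g = letters (y * x)%g.
  apply/ffunP=> j; rewrite !ffunE.
  by case: (letters x j); case: (letters y j).
case: ab => ab; [left | right].
  by apply: pauli_ext ls; rewrite /= [phase y + _]addrC -/a -/b ab.
have mI : minusI n \in phases n by rewrite minusIE mem_cycle.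
have ls' : letters (x * y)%g = letters (minusI n * (y * x))%g.
  by rewrite (letters_phaseM _ mI).
apply: pauli_ext ls'.
have z0 : \sum_j lphase (letters (minusI n) j) (letters (y * x)%g j) = 0.
  by rewrite big1 // => j _; rewrite ffunE lphase1.
transitivity (2%:R + phase (y * x)%g + 0 : 'Z_4); last by rewrite -z0.
by rewrite addr0 /= [phase y + _]addrC addrCA -/a -/b ab.
Qed.

Lemma syn_dual n (S : {group pauli n}) (E : ppauli n) : syn S E \in dual S.
Proof.
rewrite inE; apply/forallP=> s; apply/forallP=> t; rewrite !ffunE /anticommute /=.
have mIC x : (minusI n * x = x * minusI n)%g.
  by apply: phases_central; rewrite minusIE mem_cycle.
have mI2 : (minusI n * minusI n = 1)%g.
  by rewrite minusIE -expgD iIX; apply: pauli_ext => //; apply/eqP.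
have mIN x : (x == minusI n * x)%g = false.
  by rewrite eq_sym -{2}[x]mul1g (inj_eq (mulIg _)) (negPf (minusI_neq1 n)).
set x := repr E; set u := sgval s; set v := sgval t.
have xuv a b : (x * u = a * (u * x) -> x * v = b * (v * x) -> commute b u ->
    x * (u * v) = a * b * (u * v * x))%g.
  move=> xu xv bu; rewrite mulgA xu -!mulgA xv (mulgA u b) -bu.
  by rewrite !mulgA.
have [xu|xu] := commute_or_anticommute x u;
  have [xv|xv] := commute_or_anticommute x v.
- rewrite (xuv 1 1)%g ?mul1g ?mIN ?eqxx //; last exact/commute_sym/commute1.
  by rewrite xu xv !mIN.
- rewrite (xuv 1 (minusI n))%g ?mul1g ?xu ?xv ?mIN ?eqxx ?add0r //.
- rewrite (xuv (minusI n) 1)%g ?mul1g ?mulg1 ?xu ?xv ?mIN ?eqxx ?addr0 //.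
  exact/commute_sym/commute1.
- rewrite (xuv (minusI n) (minusI n))%g ?mI2 ?mul1g ?xu ?xv ?mIN ?eqxx //.
Qed.

(* Main.v *)
(* A syndrome fibre is a coset of N, and the recoveries that succeed on an error
   of nonzero syndrome form a coset of T inside that fibre, so the conditional
   success probability is #|T| / #|N| = 4 ^- k off N and the indicator of T on
   N.  The cardinality of N comes from evaluating the double character sum of
   (-1) ^ <x, s> over x in the Pauli group and s in S in both orders. *)
Require Import Defs.
From mathcomp Require Import all_boot all_order all_algebra all_fingroup cyclic.

Import Order.TTheory GRing.Theory Num.Theory GroupScope.
Local Open Scope ring_scope.

(** * The phase subgroup and the order of the Pauli group *)

Lemma phases_letters {n} (x : pauli n) :
  letters x = [ffun=> lI] -> x \in phases n.
Proof.
move=> xI; have -> : x = (iI n ^+ phase x)%g; last exact: mem_cycle.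
by rewrite iIX; apply: pauli_ext; rewrite /= ?natr_Zp.
Qed.

Lemma minusI_phases n : minusI n \in phases n.
Proof. by rewrite minusIE mem_cycle. Qed.

Lemma card_phases n : #|phases n| = 4%N.
Proof.
have : (#[iI n] %| 4)%N.
  by rewrite order_dvdn iIX; apply/eqP/pauli_ext => //; apply/eqP.
have : ~~ (#[iI n] %| 2)%N by rewrite order_dvdn -minusIE minusI_neq1.
by rewrite -orderE; case: #[iI n] => [|[|[|[|[|m]]]]].
Qed.

Lemma card_pauli n : #|{: pauli n}| = (4 * 4 ^ n)%N.
Proof.
have pauliB : bijective (@pauli_code n).
  by exists (@pauli_decode n); [exact: pauli_codeK | case].
have letterB : bijective letter_code.
  by exists letter_decode; [exact: letter_codeK | case=> [] [] []].
rewrite (bij_eq_card pauliB) card_prod card_ffun !card_ord.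
by rewrite (bij_eq_card letterB) card_prod card_bool.
Qed.

(** * The commutation sign as a symmetric bicharacter *)

Lemma anticommuteE {n} (x y : pauli n) (b : bool) :
  (x * y = minusI n ^+ b * (y * x))%g -> anticommute x y = b.
Proof.
rewrite /anticommute => ->; rewrite (inj_eq (mulIg _)).
by case: b; rewrite ?eqxx // eq_sym (negPf (minusI_neq1 n)).
Qed.

Lemma anticommuteP {n} (x y : pauli n) :
  (x * y = minusI n ^+ anticommute x y * (y * x))%g.
Proof.
have [xy|xy] := commute_or_anticommute x y.
  by rewrite (@anticommuteE _ x y false) ?mul1g.
by rewrite (@anticommuteE _ x y true).
Qed.

Lemma minusI2 n : (minusI n * minusI n = 1)%g.
Proof. by rewrite minusIE -expgD iIX; apply: pauli_ext => //; apply/eqP. Qed.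

Lemma minusIX_central {n} m (x : pauli n) : commute (minusI n ^+ m)%g x.
Proof. by apply: phases_central; rewrite groupX ?minusI_phases. Qed.

Lemma anticommuteC {n} (x y : pauli n) : anticommute x y = anticommute y x.
Proof.
apply: anticommuteE; rewrite [in RHS]anticommuteP mulgA.
by case: (anticommute y x); rewrite ?expg1 ?minusI2 !mul1g.
Qed.

(** Moving [s] past [y] and then past [x] picks up one sign each time, and signs are central. *)
Lemma anticommuteM {n} (x y s : pauli n) :
  anticommute (x * y)%g s = anticommute x s (+) anticommute y s.
Proof.
apply: anticommuteE.
rewrite -mulgA (anticommuteP y s) mulgA -(minusIX_central _ x) -mulgA (mulgA x).
rewrite (anticommuteP x s) -!mulgA mulgA.
congr (_ * _)%g.
case: (anticommute x s); case: (anticommute y s); rewrite ?mul1g ?mulg1 //.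
exact: minusI2.
Qed.

Lemma anticommuteN {n} (x y : pauli n) :
  ~~ anticommute x y = (x * y == y * x)%g.
Proof.
rewrite [(x * y)%g]anticommuteP -[X in _ == X]mul1g (inj_eq (mulIg _)).
by case: (anticommute x y); rewrite ?eqxx // (negPf (minusI_neq1 n)).
Qed.

Lemma anticommute_cent {n} (A : {group pauli n}) (x : pauli n) :
  reflect (forall s, s \in A -> anticommute s x = false) (x \in 'C(A)%g).
Proof.
apply: (iffP centP) => xA s /xA.
  by move=> xs; apply/negbTE; rewrite anticommuteN xs.
by move/negbT; rewrite anticommuteN => /eqP.
Qed.

(** A non-identity letter at a site [j] is detected by a Pauli supported on [j] alone. *)
Lemma center_pauli {n} (x : pauli n) :
  x \in 'C([set: pauli n])%g -> x \in phases n.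
Proof.
move/centP=> xC; apply/phases_letters/ffunP=> j; rewrite ffunE.
apply/eqP; apply: contraT => xj.
(* [l] is chosen to anticommute with the letter of [x] at [j]: Z against X, and X against Y or Z. *)
pose l := if letters x j is lX then lZ else lX.
pose y : pauli n := Pauli 0 [ffun i => if i == j then l else lI].
pose a := \sum_i lphase (letters x i) (letters y i).
pose b := \sum_i lphase (letters y i) (letters x i).
have : phase x + 0 + a = 0 + phase x + b.
  have xy : pauli_mul x y = pauli_mul y x := xC y (in_setT _).
  exact: (congr1 (@phase n) xy).
rewrite addr0 add0r => /addrI.
rewrite /a /b (bigD1 j) //= [RHS](bigD1 j) //= !big1 => [|i|i].
- by rewrite !ffunE eqxx !addr0 /l; case: (letters x j) xj => // _ /eqP.
- by move=> ij; rewrite ffunE (negPf ij) lphase1.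
- by move=> ij; rewrite ffunE (negPf ij); case: (letters x i).
Qed.


(** * Character sums and the order of the centralizer *)

Lemma sum_anticommute {n} (A : {group pauli n}) (y : pauli n) :
  \sum_(x in A) (-1) ^+ anticommute x y =
    (if y \in 'C(A)%g then #|A|%:R else 0) :> rat.
Proof.
case: ifPn => [/anticommute_cent yA|yA].
  by rewrite (eq_bigr (fun=> 1)) ?sumr_const // => x /yA ->.
have /exists_inP[s sA ys] : [exists s in A, anticommute s y].
  apply: contraR yA => /exists_inPn yA.
  by apply/anticommute_cent => s /yA/negbTE.
(* Translating by an [s] in [A] that anticommutes with [y] flips every term, so the sum is its own
   negative. *)
set e := \sum_(x in A) _; have : e = - e; last first.
  by move/eqP; rewrite -addr_eq0 -mulr2n mulrn_eq0 => /eqP.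
rewrite {1}/e (reindex_inj (mulgI s)) -sumrN /=.
apply: eq_big => x; first by rewrite groupMl.
by rewrite anticommuteM ys signr_addb mulN1r.
Qed.

(** Every nontrivial phase is -I or squares to -I, so having one in [S] would force -I into [S]. *)
Lemma stabilizer_phasesTI {n} (S : {group pauli n}) :
  minusI n \notin S -> (S :&: phases n = 1)%g.
Proof.
move=> mS; apply/trivgP/subsetP=> s /setIP[sS /cyclePmin[m]].
rewrite orderE card_phases => m4 sE; move: sS; rewrite {}sE inE.
have i6 : ((iI n ^+ 3) ^+ 2 = minusI n)%g.
  by rewrite -expgM (expgD _ 4 2) -{1}(card_phases n) expg_order mul1g -minusIE.
case: m m4 => [|[|[|[|]]]] // _ iS; case/negP: mS.
- by rewrite minusIE groupX.
- by rewrite minusIE.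
- by rewrite -i6 groupX.
Qed.

Lemma card_cent_pauli {n} (S : {group pauli n}) :
  minusI n \notin S -> (#|S| * #|'C(S)| = 4 * 4 ^ n)%N.
Proof.
move=> mS; apply/eqP; rewrite -(eqr_nat rat) -card_pauli natrM.
pose f (x s : pauli n) : rat := (-1) ^+ anticommute x s.
have <- : \sum_(s in S) \sum_(x in [set: pauli n]) f x s = #|{: pauli n}|%:R.
  (* Only s = 1 survives: a nonzero inner sum makes [s] central, hence a phase, and [S] contains no
     other phase. *)
  rewrite (bigD1 1%g) //= [X in _ + X]big1 ?addr0 => [|s /andP[sS s1]].
    by rewrite sum_anticommute group1 cardsT.
  rewrite sum_anticommute ifN //; apply: contra s1 => /center_pauli sI.
  by rewrite -in_set1 -[[set 1%g]](stabilizer_phasesTI S mS) inE sS.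
(* In the other order, each [x] in the centralizer contributes the order of [S] and every other [x]
   nothing. *)
have sumS x : \sum_(s in S) f x s = if x \in 'C(S)%g then #|S|%:R else 0.
  by rewrite -sum_anticommute; apply: eq_bigr => s _; rewrite /f anticommuteC.
rewrite exchange_big /= (eq_bigr _ (fun x _ => sumS x)) -big_mkcondr /=.
rewrite sumr_const mulr_natr; apply/eqP; congr (_ *+ _).
by apply: eq_card => x; rewrite [RHS]unfold_in in_setT.
Qed.

Lemma card_stab_errors {n} (S : {group pauli n}) :
  minusI n \notin S -> #|stab_errors S| = #|S|.
Proof.
move=> mS; apply/esym/card_isog/quotient_isog; last first.
  by rewrite setIC stabilizer_phasesTI.
by apply/subsetP=> x _; exact: in_norm_phases.
Qed.

(** The centralizer contains all four phases, so projecting it divides its order by exactly 4. *)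
Lemma card_cent_quotient {n} (S : {group pauli n}) :
  minusI n \notin S -> (#|S| * #|('C(S) / phases n)%g| = 4 ^ n)%N.
Proof.
move=> mS; apply/eqP; rewrite -(eqn_pmul2l (isT : (0 < 4)%N)).
rewrite -(card_cent_pauli S mS) mulnCA eqn_pmul2l ?cardG_gt0 //.
rewrite card_quotient; last by apply/subsetP=> x _; exact: in_norm_phases.
rewrite -{1}(card_phases n) Lagrange //; apply/subsetP=> c cP.
by apply/centP=> s _; exact: phases_central.
Qed.

(** * Syndrome fibres and the success of a recovery *)

Lemma synM {n} (S : {group pauli n}) (E F : ppauli n) :
  syn S (E * F)%g = syn S E + syn S F.
Proof.
rewrite -{1}(proj_surj E) -{1}(proj_surj F) -morphM ?in_norm_phases //.
apply/ffunP=> s; rewrite syn_proj !ffunE anticommuteM.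
by do 2!case: (anticommute _ _); apply/eqP.
Qed.

Lemma syn_eq0 {n} (S : {group pauli n}) (E : ppauli n) :
  (syn S E == 0) = (E \in 'C(S) / phases n)%g.
Proof.
apply/eqP/idP => [E0|/morphimP[x _ /anticommute_cent xS ->]].
  rewrite -(proj_surj E) mem_quotient //; apply/anticommute_cent => s sS.
  move/ffunP/(_ (subg S s)): E0; rewrite !ffunE subgK // anticommuteC.
  by case: anticommute.
by apply/ffunP=> s; rewrite syn_proj ffunE anticommuteC xS ?subgP.
Qed.

(** Syndromes take values in characteristic 2, so they agree exactly when their sum, the syndrome of
    [Q * E], vanishes. *)
Lemma syn_eq {n} (S : {group pauli n}) (Q E : ppauli n) :
  (syn S Q == syn S E) = (Q * E \in 'C(S) / phases n)%g.
Proof.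
rewrite -syn_eq0 synM addr_eq0; congr (_ == _).
by apply/ffunP=> s; rewrite [RHS]ffunE oppr_pchar2 ?pchar_Fp.
Qed.

Lemma card_syn_fiber {n} (S : {group pauli n}) (E : ppauli n) :
  #|[set Q | syn S Q == syn S E]| = #|('C(S) / phases n)%g|.
Proof.
rewrite -(card_rcoset ('C(S) / phases n)%g E^-1%g); apply: eq_card => Q.
by rewrite inE mem_rcoset invgK syn_eq.
Qed.

Lemma recovery_success {R : realFieldType} {n} (S : {group pauli n})
    (E : ppauli n) :
  abelian S ->
  \sum_(Q | (Q * E)%g \in stab_errors S) recovery_prob R (syn S E) Q =
    if (E \in 'C(S) / phases n)%g then (E \in stab_errors S)%:R
    else #|stab_errors S|%:R / #|('C(S) / phases n)%g|%:R.
Proof.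
move=> abS; rewrite /recovery_prob syn_eq0; case: ifP => _.
  case: (boolP (E \in _)) => ET.
    rewrite (bigD1 1%g) ?mul1g //= eqxx big1 ?addr0 // => Q.
    by case/andP=> _ /negPf ->.
  rewrite big1 // => Q; case: eqP => // ->.
  by rewrite mul1g (negPf ET).
rewrite card_syn_fiber -(card_rcoset (stab_errors S) E^-1%g) mulr_natl.
rewrite -[RHS]sumr_const; apply: eq_big => [Q|Q QT].
  by rewrite mem_rcoset invgK.
(* Commutativity of [S] puts T inside N, so every successful recovery has the measured syndrome. *)
by rewrite syn_eq (subsetP (quotientS _ abS)) // mul1r.
Qed.

(** * Error probabilities through weight enumerators *)

Lemma sum_err_weight {R : realFieldType} {n} (G : {group ppauli n})
    (p pDD : R) (A : {set ppauli n}) :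
  p < 1 ->
  \sum_(E in A) err_weight G p pDD E =
    (1 - p) ^+ n *
      (wt_enum (unsuppressed G :&: A) (p / (3%:R - 3%:R * p))
       + pDD * wt_enum (suppressed G :&: A) (p / (3%:R - 3%:R * p))).
Proof.
move=> p1; set z := p / _.
have q0 : 1 - p != 0 by rewrite subr_eq0 gt_eqF.
(* This identity is the origin of [z]: each letter, trivial or not, then carries a factor 1 - p,
   giving a common factor (1 - p)^n. *)
have zE : p / 3%:R = (1 - p) * z.
  rewrite /z -{2}[3%:R]mulr1 -mulrBr invfM mulrCA mulrA mulrACA divff //.
  by rewrite mulr1 mulrC.
have wE E : err_weight G p pDD E =
    (1 - p) ^+ n * (z ^+ wt E * (if E \in suppressed G then pDD else 1)).
  (* The subtraction [n - wt E] is truncated; this bound lets the exponents add up to [n]. *)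
  have wn : (wt E <= n)%N.
    exact: leq_trans (max_card _) (eq_leq (card_ord n)).
  by rewrite /err_weight zE exprMn !mulrA -exprD subnK.
under eq_bigr => E _ do rewrite wE.
rewrite -mulr_sumr; congr (_ * _).
rewrite (bigID (mem (unsuppressed G))) /=; congr (_ + _).
  apply: eq_big => [E|E /andP[_ EU]]; first by rewrite in_setI andbC.
  by rewrite in_setC EU mulr1.
rewrite mulr_sumr; apply: eq_big => [E|E /andP[_ EU]].
  by rewrite in_setI in_setC andbC.
by rewrite in_setC EU mulrC.
Qed.

(** The identity is unsuppressed and contributes 1. This keeps the normalization nonzero even when
    [pDD] is 0. *)
Lemma wt_enum_unsuppressed_gt0 {R : realFieldType} {n} (G : {group ppauli n})
    (z : R) :
  0 <= z -> 0 < wt_enum (unsuppressed G) z.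
Proof.
move=> z0; rewrite /wt_enum (bigD1 1%g) /=.
  rewrite -[1%g](morph1 (coset_morphism (phases n))) wt_proj /pwt.
  rewrite (eq_card0 (A := _)) => [|j]; last by rewrite !inE ffunE eqxx.
  by rewrite expr0 ltr_pwDl ?ltr01 // sumr_ge0 // => E _; rewrite exprn_ge0.
rewrite inE; apply/forall_inP=> F _; rewrite -[1%g](proj_surj 1%g).
by rewrite -(proj_surj F) repr_group pcommute_proj mul1g mulg1.
Qed.

Theorem lemma9 (R : realFieldType) (n k : nat) (S L : {group pauli n})
    (G : {group ppauli n}) (p pDD : R) :
  (1 <= k <= n)%N ->
  stabilizer_code k S ->
  logical_paulis S L ->
  G != 1%G ->
  0 <= p < 1 ->
  0 <= pDD <= 1 ->
  let z := p / (3%:R - 3%:R * p) in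
  let W := fun A : {set ppauli n} => wt_enum A z in
  let T := stab_errors S in
  let N := zero_syn_errors S L in
  let U := unsuppressed G in
  let V := suppressed G in
  1 - F_LDD S G p pDD =
    ((W (U :\: T) - 4%:R ^- k * W (U :\: N))
     + pDD * (W (V :\: T) - 4%:R ^- k * W (V :\: N)))
    / (W U + pDD * W V).
Proof.
move=> /andP[_ kn] [cardS mS] [_ CE _] _ /andP[p0 p1] /andP[d0 _] z W T N U V.
have NE : N = ('C(S) / phases n)%g by rewrite /N /zero_syn_errors -CE.
have abS : abelian S by rewrite /abelian CE mulG_subl.
have ratio : #|T|%:R / #|N|%:R = 4%:R ^- k :> R.
  have cT : #|T| = (2 ^ (n - k))%N by rewrite card_stab_errors.
  (* Cancel one factor |T| = 2^(n-k) from |T| |N| = 4^n = 2^(n-k) 2^(n-k) 4^k. *)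
  have cN : #|N| = (#|T| * 4 ^ k)%N.
    apply/eqP; rewrite -(@eqn_pmul2l #|T|) ?cT ?expn_gt0 //.
    by rewrite -cardS NE card_cent_quotient // cardS mulnA -expnMn -expnD subnK.
  by rewrite cN natrM natrX invfM mulrA divff ?mul1r // pnatr_eq0 cT expn_eq0.
have q0 : (1 - p) ^+ n != 0 by rewrite expf_neq0 // subr_eq0 gt_eqF.
have z0 : 0 <= z.
  by rewrite divr_ge0 // subr_ge0 ler_piMr // ltW.
have D0 : W U + pDD * W V != 0.
  rewrite gt_eqF // ltr_wpDr ?wt_enum_unsuppressed_gt0 // mulr_ge0 //.
  by rewrite sumr_ge0 // => E _; rewrite exprn_ge0.
set D := \sum_F err_weight G p pDD F.
have DE : D = (1 - p) ^+ n * (W U + pDD * W V).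
  have := sum_err_weight G p pDD [set: ppauli n] p1; rewrite !setIT => <-.
  by apply: eq_bigl => E; rewrite in_setT.
have sumP (A : {set ppauli n}) :
  \sum_E err_prob G p pDD E * (E \in A)%:R =
    (W (U :&: A) + pDD * W (V :&: A)) / (W U + pDD * W V).
  under eq_bigr => E _ do rewrite mulr_natr mulrb.
  rewrite -big_mkcond /= -mulr_suml sum_err_weight // -/D DE invfM.
  by rewrite mulrACA divff // mul1r.
have sum1 : 1 = \sum_E err_prob G p pDD E.
  by rewrite -mulr_suml -/D divff // DE mulf_neq0.
rewrite /F_LDD {1}sum1 -sumrB.
(* Given E, failure has probability [E not in T] - 4^-k [E not in N]: on N the second term vanishes,
   and off N, hence off T, it is 1 - 4^-k. *)
transitivity (\sum_E (err_prob G p pDD E * (E \in ~: T)%:R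
   - 4%:R ^- k * (err_prob G p pDD E * (E \in ~: N)%:R))).
  apply: eq_bigr => E _; rewrite -mulr_sumr recovery_success // -NE ratio.
  rewrite !inE mulrCA -mulrBr -[X in X - _]mulr1 -mulrBr; congr (_ * _).
  case: ifP => EN.
    by rewrite mulr0 subr0; case: (E \in T); rewrite ?subrr ?subr0.
  have -> : E \in T = false; last by rewrite mulr1.
  by apply: contraFF EN; rewrite NE; exact: (subsetP (quotientS _ abS)).
rewrite sumrB -mulr_sumr !sumP -!setDE mulrA -mulrBl; congr (_ / _).
by rewrite mulrDr opprD addrACA mulrBr [4%:R ^- k * (_ * _)]mulrCA.
Qed.
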